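(* For all $m,n\in\mathbb{N}$, both $$S^m_n:=\sum_{k=0}^n(-1)^kq^{k(k-1)+2m(n-k)}\begin{bmatrix}2n\\2k\end{bmatrix}_q\quad\text{and}\quad T^m_n:=\sum_{0\le k<n}(-1)^kq^{k(k-1)+2m(n-1-k)}\begin{bmatrix}2n\\2k+1\end{bmatrix}_q$$ are divisible by $(-q;q)_n=\prod_{0<k\le n}(1+q^k)$ in $\mathbb{Z}[q]$. Moreover, for any $m,n\in\mathbb{N}$ and $\delta\in\{0,1\}$, $$\sum_{k=0}^n(-1)^kq^{k(k+2m-1)}\begin{bmatrix}2n\\2k+\delta\end{bmatrix}_q\equiv 0\ \ (\mathrm{mod}\ (-q;q)_n)$$ in $\mathbb{Z}[q]$.
   Context: For $n\in\mathbb{N}$, $(a;q)_n=\prod_{0\le k<n}(1-aq^k)$. For $n,k\in\mathbb{N}$, $\begin{bmatrix}n\\k\end{bmatrix}_q=\frac{(q;q)_n}{(q;q)_k(q;q)_{n-k}}$ if $k\le n$ and $0$ if $k>n$ (these are polynomials in $q$ with integer coefficients). *)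

(* Defs.v *)
From mathcomp Require Import all_boot all_order all_algebra.
From mathcomp Require Import ring.
Set Implicit Arguments.
Unset Strict Implicit.
Unset Printing Implicit Defensive.
Import GRing.Theory.
Local Open Scope ring_scope.

(* (a;q)_n *)
Definition qpoch (R : nzRingType) (a q : R) (n : nat) : R :=
  \prod_(k < n) (1 - a * q ^+ k).

(* The Gaussian binomial in Z[q], with q = 'X. Here %/ is pseudo-division, but
   the divisor has leading coefficient 1 or -1, so this is the exact quotient:
   see qbinomE. *)
Definition qbinom (n k : nat) : {poly int} :=
  if (k <= n)%N
  then qpoch 'X 'X n %/ (qpoch 'X 'X k * qpoch 'X 'X (n - k))
  else 0.

(* Divisibility in the ring Z[q]. The library's %| on {poly int} is only
   divisibility up to a nonzero integer factor. *)
Definition zdvdp (d p : {poly int}) : Prop := exists r : {poly int}, p = r * d.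

(* Truncated subtraction is harmless in k * (k - 1): the product is 0 at k = 0. *)
Definition qS (m n : nat) : {poly int} :=
  \sum_(0 <= k < n.+1)
    (-1) ^+ k * 'X ^+ (k * (k - 1) + 2 * m * (n - k)) * qbinom (2 * n) (2 * k).

Definition qT (m n : nat) : {poly int} :=
  \sum_(0 <= k < n)
    (-1) ^+ k * 'X ^+ (k * (k - 1) + 2 * m * (n - 1 - k))
    * qbinom (2 * n) (2 * k + 1).

Lemma qpochS (n : nat) :
  qpoch 'X 'X n.+1 = qpoch 'X 'X n * (1 - 'X ^+ n.+1) :> {poly int}.
Proof. by rewrite /qpoch big_ord_recr /= exprS. Qed.

Lemma qpoch_dvd (i j : nat) :
  zdvdp (qpoch 'X 'X i * qpoch 'X 'X j) (qpoch 'X 'X (i + j)).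
Proof.
have [n] := ubnP (i + j)%N; elim: n i j => // n IHn [|i] [|j] le_n.
- by exists 1; rewrite /qpoch !big_ord0 !mul1r.
- by exists 1; rewrite add0n {2}/qpoch big_ord0 !mul1r.
- by exists 1; rewrite addn0 {3}/qpoch big_ord0 mulr1 mul1r.
have [r1 e1] : zdvdp (qpoch 'X 'X i * qpoch 'X 'X j.+1) (qpoch 'X 'X (i + j.+1)).
  exact: IHn.
have [r2 e2] : zdvdp (qpoch 'X 'X i.+1 * qpoch 'X 'X j) (qpoch 'X 'X (i.+1 + j)).
  by apply: IHn; rewrite addSnnS.
exists (r1 + 'X ^+ i.+1 * r2).
have -> : qpoch 'X 'X (i.+1 + j.+1) =
    qpoch 'X 'X (i + j.+1) * (1 - 'X ^+ i.+1)
    + 'X ^+ i.+1 * (qpoch 'X 'X (i.+1 + j) * (1 - 'X ^+ j.+1)) :> {poly int}.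
  by rewrite addSn qpochS addSnnS -addSn exprD; ring.
by rewrite e1 e2 !qpochS; ring.
Qed.

Lemma lead_coef_qpoch (n : nat) :
  lead_coef (qpoch 'X 'X n : {poly int}) \is a GRing.unit.
Proof.
elim: n => [|n IHn]; first by rewrite /qpoch big_ord0 lead_coef1 unitr1.
rewrite qpochS lead_coefM unitrM IHn /= -opprB lead_coefN.
by rewrite (monicP _) ?unitrN1 // monicXnsubC.
Qed.

Lemma qbinomE (n k : nat) : (k <= n)%N ->
  qbinom n k * (qpoch 'X 'X k * qpoch 'X 'X (n - k)) = qpoch 'X 'X n.
Proof.
move=> le_kn; rewrite /qbinom le_kn.
have [r] := qpoch_dvd k (n - k); rewrite subnKC // => ->.
by rewrite Pdiv.IdomainUnit.mulpK // lead_coefM unitrM !lead_coef_qpoch.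
Qed.

(* Main.v *)
(** Absorption gives S^m_n - S^(m+1)_n = (1 - q^(2n)) A and
    T^m_n - q T^(m+1)_n = (1 - q^(2n)) B, where by q-Pascal A and B are
    combinations of the S and T of index n - 1, hence divisible by (-q;q)_(n-1).
    As 1 - q^(2n) = (1 - q^n)(1 + q^n), divisibility of S^m_n, and of T^m_n, by
    (-q;q)_n does not depend on m (q is a unit modulo (-q;q)_n).  The reflection
    k -> n - k relates S^m_n to S^(n-1-m)_n up to a sign and a power of q. At a
    central m it forces S^m_n = 0 for n odd and, combined with the shift
    relation, S^m_n = (1 + q^n) A for n even; for T the parities are exchanged.
    The last family of sums is obtained from S and T by reflection. *)
Require Import Defs.
From mathcomp Require Import all_boot all_order all_algebra.
From mathcomp Require Import zify ring.
Set Implicit Arguments.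
Unset Strict Implicit.
Unset Printing Implicit Defensive.
Import GRing.Theory.
Local Open Scope ring_scope.

(** * Divisibility in Z[q] and invertibility of q modulo (-q;q)_n *)

Lemma zdvdp_mulr (d p r : {poly int}) : zdvdp d p -> zdvdp d (p * r).
Proof. by case=> s ->; exists (s * r); rewrite mulrAC. Qed.

Lemma zdvdp_mull (d p r : {poly int}) : zdvdp d p -> zdvdp d (r * p).
Proof. by rewrite mulrC; apply: zdvdp_mulr. Qed.

Lemma zdvdpD (d p r : {poly int}) : zdvdp d p -> zdvdp d r -> zdvdp d (p + r).
Proof. by move=> [s ->] [t ->]; exists (s + t); rewrite mulrDl. Qed.

Lemma zdvdpB (d p r : {poly int}) : zdvdp d p -> zdvdp d r -> zdvdp d (p - r).
Proof. by move=> [s ->] [t ->]; exists (s - t); rewrite mulrBl. Qed.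

Lemma zdvdp0 (d : {poly int}) : zdvdp d 0.
Proof. by exists 0; rewrite mul0r. Qed.

Lemma qpochN_recr (n : nat) :
  qpoch (- 'X) 'X n.+1 = qpoch (- 'X) 'X n * (1 + 'X ^+ n.+1) :> {poly int}.
Proof. by rewrite /qpoch big_ord_recr /= mulNr opprK exprS. Qed.

Lemma qpochN_mod_X (n : nat) : zdvdp 'X (qpoch (- 'X) 'X n - 1).
Proof.
elim: n => [|n [r IHn]]; first by rewrite /qpoch big_ord0 subrr; apply: zdvdp0.
exists (r + qpoch (- 'X) 'X n * 'X ^+ n).
by rewrite qpochN_recr mulrDl -IHn exprS; ring.
Qed.

(** With d = (-q;q)_n = 1 + u q, the equation q p = r d gives p = p d - u q p = (p - u r) d. *)
Lemma zdvdp_qpochN_cancel (n e : nat) (p : {poly int}) :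
  zdvdp (qpoch (- 'X) 'X n) ('X ^+ e * p) -> zdvdp (qpoch (- 'X) 'X n) p.
Proof.
elim: e p => [|e IHe] p; first by rewrite mul1r.
rewrite exprSr -mulrA => /IHe [r eXp].
have [u eu] := qpochN_mod_X n; exists (p - u * r).
by rewrite mulrBl -mulrA -eXp mulrA -eu; ring.
Qed.

(** * Gaussian binomials: symmetry, absorption, q-Pascal *)

Lemma qpoch_neq0 (n : nat) : qpoch 'X 'X n != 0 :> {poly int}.
Proof.
by rewrite -lead_coef_eq0; apply: contraTneq (lead_coef_qpoch n) => ->; rewrite unitr0.
Qed.

Lemma qbinom_small (n k : nat) : (n < k)%N -> qbinom n k = 0.
Proof. by move=> lt_nk; rewrite /qbinom leqNgt lt_nk. Qed.

(** Z[q] is a domain, so the product formula determines the coefficient; symmetry and q-Pascal are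
    then checked after clearing denominators. *)
Lemma qbinomP (i j : nat) (p : {poly int}) :
  p * (qpoch 'X 'X i * qpoch 'X 'X j) = qpoch 'X 'X (i + j) ->
  p = qbinom (i + j) i.
Proof.
move=> ep; apply: (mulIf (mulf_neq0 (qpoch_neq0 i) (qpoch_neq0 j))).
by rewrite ep -{3}(addKn i j) qbinomE ?leq_addr.
Qed.

Lemma qbinomDE (i j : nat) :
  qbinom (i + j) i * (qpoch 'X 'X i * qpoch 'X 'X j) = qpoch 'X 'X (i + j).
Proof. by rewrite -{2}(addKn i j) qbinomE ?leq_addr. Qed.

Lemma qbinom0 (n : nat) : qbinom n 0 = 1.
Proof. by rewrite -[n]add0n -(@qbinomP 0 n 1) // {1}/qpoch big_ord0 !mul1r. Qed.

Lemma qbinom_sym (n k : nat) : (k <= n)%N -> qbinom n (n - k) = qbinom n k.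
Proof.
move=> le_kn; have symD i j : qbinom (i + j) i = qbinom (i + j) j.
  rewrite [in RHS]addnC; apply: qbinomP.
  by rewrite [X in _ * X]mulrC qbinomDE addnC.
by rewrite -{1}(subnK le_kn) symD subnK.
Qed.

Lemma qbinom_absorb (n k : nat) : (k <= n.+1)%N ->
  (1 - 'X ^+ (n.+1 - k)) * qbinom n.+1 k = (1 - 'X ^+ n.+1) * qbinom n k.
Proof.
rewrite leq_eqVlt ltnS => /predU1P[-> | le_kn].
  by rewrite subnn expr0 subrr mul0r qbinom_small ?mulr0.
rewrite -(subnKC le_kn) -addnS addKn; set j := (n - k)%N.
apply: (mulIf (mulf_neq0 (qpoch_neq0 k) (qpoch_neq0 j))).
have := qbinomDE k j; have := qbinomDE k j.+1.
rewrite addnS !qpochS => e1 e2.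
transitivity (qbinom (k + j).+1 k *
  (qpoch 'X 'X k * (qpoch 'X 'X j * (1 - 'X ^+ j.+1)))); first by ring.
by rewrite e1 -e2; ring.
Qed.

Lemma qbinom_pascal (n k : nat) :
  qbinom n.+1 k.+1 = qbinom n k.+1 + 'X ^+ (n - k) * qbinom n k.
Proof.
have [lt_nk | ] := ltnP n k.
  by rewrite !qbinom_small ?mulr0 ?addr0 // !ltnS // ltnW.
rewrite leq_eqVlt => /predU1P[-> | lt_kn].
  rewrite subnn mul1r (@qbinom_small n n.+1) // add0r.
  by rewrite -(@qbinom_sym _ n.+1) // -(@qbinom_sym n n) // !subnn !qbinom0.
have -> : n = (k.+1 + (n - k.+1))%N by rewrite subnKC.
move: (n - k.+1)%N => j {lt_kn}.
have -> : (k.+1 + j - k)%N = j.+1 by lia.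
rewrite -[in LHS]addnS; apply/esym/qbinomP.
have := qbinomDE k.+1 j; have := qbinomDE k j.+1.
rewrite addnS -addSn (qpochS k) (qpochS j) => e1 e2.
(* Both terms become multiples of (q;q)_(k+1+j), with factors 1 - q^(j+1) and q^(j+1) (1 - q^(k+1)),
   which add up to 1 - q^(k+j+2). *)
transitivity ((qbinom (k.+1 + j) k.+1 * (qpoch 'X 'X k * (1 - 'X ^+ k.+1)
    * qpoch 'X 'X j)) * (1 - 'X ^+ j.+1) + 'X ^+ j.+1 * (1 - 'X ^+ k.+1)
    * (qbinom (k.+1 + j) k * (qpoch 'X 'X k * (qpoch 'X 'X j * (1 - 'X ^+ j.+1)))) :> {poly int}).
  by ring.
by rewrite e1 e2 addnS (qpochS (k.+1 + j)) -addnS exprD; ring.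
Qed.

(** * Shift in m and reduction of the index *)

Definition qA (m n : nat) : {poly int} :=
  \sum_(0 <= k < n.+2)
    (-1) ^+ k * 'X ^+ (k * (k - 1) + 2 * m * (n.+1 - k)) * qbinom (2 * n).+1 (2 * k).

Definition qB (m n : nat) : {poly int} :=
  \sum_(0 <= k < n.+1)
    (-1) ^+ k * 'X ^+ (k * (k - 1) + 2 * m * (n - k)) * qbinom (2 * n).+1 (2 * k + 1).

(** Raising m multiplies term k by q^(2n+2-2k), so absorption applies termwise. At k = n+1 the
    factor is 1 and the term of [qA] is zero. *)
Lemma qS_shift (m n : nat) :
  qS m n.+1 = qS m.+1 n.+1 + (1 - 'X ^+ (2 * n.+1)) * qA m n.
Proof.
rewrite mulr_sumr -big_split /=; apply: eq_big_nat => k /andP[_ lt_k].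
have e2n : (2 * n.+1)%N = (2 * n).+2 by lia.
set a := (k * (k - 1) + 2 * m * (n.+1 - k))%N.
have -> : (k * (k - 1) + 2 * m.+1 * (n.+1 - k) = a + ((2 * n).+2 - 2 * k))%N.
  by rewrite /a; nia.
rewrite e2n exprD [(1 - _) * _]mulrCA -qbinom_absorb; last lia.
by ring.
Qed.

(** Absorption now needs q^(2n+2-(2k+1)), one power more than raising m supplies; hence the extra
    factor q. *)
Lemma qT_shift (m n : nat) :
  qT m n.+1 = 'X * qT m.+1 n.+1 + (1 - 'X ^+ (2 * n.+1)) * qB m n.
Proof.
rewrite !mulr_sumr -big_split /=; apply: eq_big_nat => k /andP[_ lt_k].
have e2n : (2 * n.+1)%N = (2 * n).+2 by lia.
have -> : (n.+1 - 1 = n)%N by lia.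
have expS_in c (s p : {poly int}) : 'X * (s * 'X ^+ c * p) = s * 'X ^+ c.+1 * p.
  by rewrite exprS; ring.
rewrite expS_in.
set a := (k * (k - 1) + 2 * m * (n - k))%N.
have -> : (k * (k - 1) + 2 * m.+1 * (n - k)).+1
    = (a + ((2 * n).+2 - (2 * k + 1)))%N by rewrite /a; nia.
rewrite e2n exprD [(1 - _) * _]mulrCA -qbinom_absorb; last lia.
by ring.
Qed.

(** The odd-column half of q-Pascal is reindexed by one, which reverses its sign. The exponent 2m +
    2n - 1 truncates only at m = n = 0, where T is an empty sum. *)
Lemma qA_rec (m n : nat) :
  qA m n = 'X ^+ (2 * m) * qS m n - 'X ^+ (2 * m + 2 * n - 1) * qT m n.
Proof.
have -> : qS m n = \sum_(0 <= k < n.+2) (-1) ^+ k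
    * 'X ^+ (k * (k - 1) + 2 * m * (n - k)) * qbinom (2 * n) (2 * k).
  by rewrite [RHS]big_nat_recr //= qbinom_small ?mulr0 ?addr0; last lia.
have -> : qT m n = \sum_(0 <= k < n.+1) (-1) ^+ k
    * 'X ^+ (k * (k - 1) + 2 * m * (n - 1 - k)) * qbinom (2 * n) (2 * k + 1).
  by rewrite [RHS]big_nat_recr //= qbinom_small ?mulr0 ?addr0; last lia.
rewrite /qA !(@big_nat_recl _ _ _ n.+1) // !qbinom0 mulrDr -addrA.
congr (_ + _).
  by rewrite !subn0 !mulr1 !mul1r -exprD; congr ('X ^+ _); lia.
rewrite !mulr_sumr -sumrB; apply: eq_big_nat => k /andP[_ le_k].
have -> : (2 * k.+1)%N = (2 * k).+2 by lia.
(* At k = n truncated subtraction breaks the exponent identities, but all three coefficients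
   vanish. *)
have [lt_kn | le_nk] := ltnP k n; last first.
  by rewrite !qbinom_small ?mulr0 ?subrr //; lia.
set a := (k.+1 * (k.+1 - 1) + 2 * m * (n - k.+1))%N.
set b := (k * (k - 1) + 2 * m * (n - 1 - k))%N.
have -> : (k.+1 * (k.+1 - 1) + 2 * m * (n.+1 - k.+1) = 2 * m + a)%N.
  by rewrite /a; nia.
have eab : 'X ^+ (2 * m + a) * 'X ^+ (2 * n - (2 * k).+1)
    = 'X ^+ (2 * m + 2 * n - 1) * 'X ^+ b :> {poly int}.
  by rewrite -!exprD; congr ('X ^+ _); rewrite /a /b; nia.
rewrite qbinom_pascal addn1 mulrDr [X in _ + X = _]mulrA -[X in _ + X * _ = _]mulrA.
by rewrite eab exprD exprS; ring.
Qed.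

(** The factor q^(2n-2k) from q-Pascal turns m into m+1 in the S part. *)
Lemma qB_rec (m n : nat) : qB m n = 'X ^+ (2 * m) * qT m n + qS m.+1 n.
Proof.
have -> : qT m n = \sum_(0 <= k < n.+1) (-1) ^+ k
    * 'X ^+ (k * (k - 1) + 2 * m * (n - 1 - k)) * qbinom (2 * n) (2 * k + 1).
  by rewrite big_nat_recr //= qbinom_small ?mulr0 ?addr0 // addn1.
rewrite mulr_sumr -big_split /=; apply: eq_big_nat => k /andP[_ le_k].
rewrite addn1 qbinom_pascal.
have -> : (k * (k - 1) + 2 * m.+1 * (n - k)
    = (k * (k - 1) + 2 * m * (n - k)) + (2 * n - 2 * k))%N by nia.
have [lt_kn | le_nk] := ltnP k n; last first.
  by rewrite (@qbinom_small _ (2 * k).+1) ?exprD; [ring | lia].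
have -> : (k * (k - 1) + 2 * m * (n - k)
    = 2 * m + (k * (k - 1) + 2 * m * (n - 1 - k)))%N by nia.
by rewrite !exprD; ring.
Qed.

(** * Reflection k -> n - k *)

Lemma sign_addn (k j : nat) : (-1) ^+ k = (-1) ^+ (k + j) * (-1) ^+ j :> {poly int}.
Proof. by rewrite exprD -mulrA -expr2 sqrr_sign mulr1. Qed.

Lemma qbinom_even_sym (k j : nat) :
  qbinom (2 * (k + j)) (2 * k) = qbinom (2 * (k + j)) (2 * j).
Proof. by rewrite -qbinom_sym; [congr qbinom | ]; lia. Qed.

Lemma qbinom_odd_sym (k j : nat) :
  qbinom (2 * (k + j).+1) (2 * k + 1) = qbinom (2 * (k + j).+1) (2 * j + 1).
Proof. by rewrite -qbinom_sym; [congr qbinom | ]; lia. Qed.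

(** The powers q^u and q^v stand on both sides so that no negative exponent is needed. *)
Lemma sum_reflect (n u v : nat) (f g : nat -> nat) (c d : nat -> {poly int}) :
  (forall k j, (k + j)%N = n -> (u + f k = v + g j)%N /\ c k = d j) ->
  'X ^+ u * (\sum_(0 <= k < n.+1) (-1) ^+ k * 'X ^+ f k * c k)
    = (-1) ^+ n * ('X ^+ v * (\sum_(0 <= k < n.+1) (-1) ^+ k * 'X ^+ g k * d k)).
Proof.
move=> fg; rewrite [in RHS]big_nat_rev /= !mulr_sumr.
apply: eq_big_nat => k /andP[_ le_k]; rewrite add0n subSS.
have ekj : (k + (n - k))%N = n by lia.
have [euv ->] := fg _ _ ekj.
rewrite (sign_addn k (n - k)) ekj.
transitivity ((-1) ^+ n * (-1) ^+ (n - k) * ('X ^+ u * 'X ^+ f k) * d (n - k)%N).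
  by ring.
by rewrite -(exprD 'X) euv exprD; ring.
Qed.

(** As k + j - 1 = m1 + m2, k(k-1) - j(j-1) = (k - j)(m1 + m2), and the remaining terms differ by
    the opposite amount. *)
Lemma reflect_exponent (k j m1 m2 : nat) : (k + j)%N = (m1 + m2).+1 ->
  ((k + j) * m2 + (k * (k - 1) + 2 * m1 * j)
    = (k + j) * m1 + (j * (j - 1) + 2 * m2 * k))%N.
Proof.
move=> e; have sq i : (i * (i - 1) + i = i * i)%N by case: i => // i; nia.
by have := sq k; have := sq j; have := congr1 (muln k) e; have := congr1 (muln j) e; nia.
Qed.

Lemma qS_reflect (m1 m2 n : nat) : (m1 + m2).+1 = n ->
  'X ^+ (n * m2) * qS m1 n = (-1) ^+ n * ('X ^+ (n * m1) * qS m2 n).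
Proof.
move=> en; apply: sum_reflect => k j ekj; split; last by rewrite -ekj qbinom_even_sym.
have -> : (n - k = j)%N by lia.
have -> : (n - j = k)%N by lia.
by rewrite -ekj reflect_exponent // ekj.
Qed.

(** T of index n+1 has n+1 terms, one fewer than S of that index, so its sign is (-1)^n: this
    exchanges the parities. *)
Lemma qT_reflect (m1 m2 n : nat) : (m1 + m2).+1 = n ->
  'X ^+ (n * m2) * qT m1 n.+1 = (-1) ^+ n * ('X ^+ (n * m1) * qT m2 n.+1).
Proof.
move=> en; apply: sum_reflect => k j ekj; split; last by rewrite -ekj qbinom_odd_sym.
have -> : (n.+1 - 1 - k = j)%N by lia.
have -> : (n.+1 - 1 - j = k)%N by lia.
by rewrite -ekj reflect_exponent // ekj.
Qed.

(** * Central values of m *)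

Lemma oppr_eq_polyint (p : {poly int}) : p = - p -> p = 0.
Proof.
move=> ep; apply/polyP => i; have := congr1 (fun r : {poly int} => r`_i) ep.
by rewrite coefN coef0; move: p`_i => c; lia.
Qed.

Lemma polyXn_neq0 (e : nat) : 'X^e != 0 :> {poly int}.
Proof. by rewrite monic_neq0 ?monicXn. Qed.

Lemma qS_mid_odd (p : nat) : qS p (2 * p).+1 = 0.
Proof.
have := @qS_reflect p p (2 * p).+1 ltac:(lia).
rewrite -signr_odd mulnC /= mul2n odd_double expr1 mulN1r -mulrN.
by move/(mulfI (polyXn_neq0 _))/oppr_eq_polyint.
Qed.

Lemma qT_mid_even (p : nat) : qT p (2 * p).+2 = 0.
Proof.
have := @qT_reflect p p (2 * p).+1 ltac:(lia).
rewrite -signr_odd mulnC /= mul2n odd_double expr1 mulN1r -mulrN.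
by move/(mulfI (polyXn_neq0 _))/oppr_eq_polyint.
Qed.

(* Reflection gives [qS p.+1 n = X^n * qS p n] for [n = 2p + 2], so the shift
   relation has the factor [1 - X^n] on both sides. *)
Lemma qS_mid_even (p : nat) :
  qS p (2 * p).+2 = (1 + 'X ^+ (2 * p).+2) * qA p (2 * p).+1.
Proof.
set n := (2 * p).+2.
have eS : qS p.+1 n = 'X^n * qS p n.
  have := @qS_reflect p.+1 p n ltac:(lia).
  rewrite -signr_odd /n /= mul2n odd_double expr0 mul1r mulnS addnC exprD -mulrA.
  by move/(mulfI (polyXn_neq0 _)).
have nz : 1 - 'X^n != 0 :> {poly int}.
  by rewrite -opprB oppr_eq0 monic_neq0 // monicXnsubC.
apply: (mulfI nz); rewrite mulrBl mul1r -eS {1}/n qS_shift addrAC subrr add0r.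
by rewrite mulrA mulnC exprM -/n; ring.
Qed.

(** Here q T^(p+1) = q^(n+1) T^p, with n = 2p + 2, so 1 - q^(n+1) cancels from the shift
    relation. *)
Lemma qT_mid_odd (p : nat) :
  qT p (2 * p).+3 = (1 + 'X ^+ (2 * p).+3) * qB p (2 * p).+2.
Proof.
set n := (2 * p).+2.
have eT : qT p.+1 n.+1 = 'X^n * qT p n.+1.
  have := @qT_reflect p.+1 p n ltac:(lia).
  rewrite -signr_odd /n /= mul2n odd_double expr0 mul1r mulnS addnC exprD -mulrA.
  by move/(mulfI (polyXn_neq0 _)).
have nz : 1 - 'X^(n.+1) != 0 :> {poly int}.
  by rewrite -opprB oppr_eq0 monic_neq0 // monicXnsubC.
apply: (mulfI nz); rewrite mulrBl mul1r exprS -mulrA -eT {1}qT_shift.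
by rewrite addrAC subrr add0r mulrA mulnC exprM -/n (exprS 'X n); ring.
Qed.

(** Index 1 has no central pair: it would need m1 + m2 + 1 = 0. *)
Lemma qT_1 (m : nat) : qT m 1 = 1 + 'X.
Proof.
rewrite /qT big_nat1 (qbinom_pascal 1 0) (qbinom_pascal 0 0).
by rewrite (qbinom_small (ltnSn 0)) !qbinom0 !muln0 !mulr1 add0r mul1r.
Qed.

(** * Divisibility of S and T *)

Lemma zdvdp_step (n : nat) (p : {poly int}) :
  zdvdp (qpoch (- 'X) 'X n) p ->
  zdvdp (qpoch (- 'X) 'X n.+1) ((1 + 'X ^+ n.+1) * p).
Proof. by case=> r ->; exists r; rewrite qpochN_recr; ring. Qed.

Lemma zdvdp_qS_qT (n m : nat) :
  zdvdp (qpoch (- 'X) 'X n) (qS m n) /\ zdvdp (qpoch (- 'X) 'X n) (qT m n).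
Proof.
elim: n m => [|n IHn] m.
  by rewrite /qpoch big_ord0; split; [exists (qS m 0) | exists (qT m 0)];
    rewrite mulr1.
have dA m' : zdvdp (qpoch (- 'X) 'X n) (qA m' n).
  by rewrite qA_rec; have [? ?] := IHn m'; apply: zdvdpB; apply: zdvdp_mull.
have dB m' : zdvdp (qpoch (- 'X) 'X n) (qB m' n).
  rewrite qB_rec; apply: zdvdpD; first by apply: zdvdp_mull; case: (IHn m').
  by case: (IHn m'.+1).
set D := qpoch (- 'X) 'X n.+1.
have step p : zdvdp (qpoch (- 'X) 'X n) p -> zdvdp D ((1 - 'X ^+ (2 * n.+1)) * p).
  move=> dp; have -> : 1 - 'X ^+ (2 * n.+1)
      = (1 - 'X ^+ n.+1) * (1 + 'X ^+ n.+1) :> {poly int}.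
    by rewrite mulnC exprM; ring.
  by rewrite -mulrA; apply/zdvdp_mull/zdvdp_step.
have shiftS m' : zdvdp D (qS m' n.+1) <-> zdvdp D (qS m'.+1 n.+1).
  rewrite qS_shift; split=> [dS|dS]; last by apply: zdvdpD => //; apply: step.
  by rewrite -(addrK ((1 - 'X ^+ (2 * n.+1)) * qA m' n) (qS _ _));
    apply: zdvdpB => //; apply: step.
have shiftT m' : zdvdp D (qT m' n.+1) <-> zdvdp D (qT m'.+1 n.+1).
  rewrite qT_shift; split=> [dT|dT]; last first.
    by apply: zdvdpD; [apply: zdvdp_mull | apply: step].
  apply: (@zdvdp_qpochN_cancel _ 1); rewrite expr1.
  by rewrite -(addrK ((1 - 'X ^+ (2 * n.+1)) * qB m' n) (_ * _));
    apply: zdvdpB => //; apply: step.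
(* Chaining the shifts through m = 0 lets one central value settle every m. *)
have allS m' : zdvdp D (qS m' n.+1) -> zdvdp D (qS m n.+1).
  suff H i : zdvdp D (qS i n.+1) <-> zdvdp D (qS 0 n.+1) by move/H => d0; apply/H.
  by elim: i => // i [to0 of0]; split=> [/(shiftS i).2/to0 | /of0/(shiftS i).1].
have allT m' : zdvdp D (qT m' n.+1) -> zdvdp D (qT m n.+1).
  suff H i : zdvdp D (qT i n.+1) <-> zdvdp D (qT 0 n.+1) by move/H => d0; apply/H.
  by elim: i => // i [to0 of0]; split=> [/(shiftT i).2/to0 | /of0/(shiftT i).1].
have [p [en | en]] : exists p, n = (2 * p)%N \/ n = (2 * p).+1.
  by exists n./2; lia.
- split; first by apply: (allS p); rewrite en qS_mid_odd; apply: zdvdp0.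
  case: p en => [|p] en.
    by exists 1; rewrite /D en qT_1 mul1r qpochN_recr {1}/qpoch big_ord0 mul1r.
  have {}en : n = (2 * p).+2 by lia.
  by apply: (allT p); rewrite /D en qT_mid_odd -en; apply: zdvdp_step.
- split; last by apply: (allT p); rewrite en qT_mid_even; apply: zdvdp0.
  by apply: (allS p); rewrite /D en qS_mid_even -en; apply: zdvdp_step.
Qed.

(** * The last family of sums *)

Lemma zdvdp_sum_qbinom_even (m n : nat) :
  zdvdp (qpoch (- 'X) 'X n)
    (\sum_(0 <= k < n.+1)
       (-1) ^+ k * 'X ^+ (k * (k + 2 * m - 1)) * qbinom (2 * n) (2 * k)).
Proof.
(* For k + j = n, n(n-1) + k(k+2m-1) = j(j-1) + 2(m+n-1)k, so after multiplication by q^(n(n-1)) the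
   reflected sum is S^(m+n-1)_n up to sign. *)
apply: (@zdvdp_qpochN_cancel _ (n * (n - 1))).
rewrite (@sum_reflect n _ 0 _ (fun k => k * (k - 1) + 2 * (m + n - 1) * (n - k))%N
  _ (fun k => qbinom (2 * n) (2 * k))).
  by rewrite mul1r; apply: zdvdp_mull; case: (zdvdp_qS_qT n (m + n - 1)).
move=> k j ekj; split; last by rewrite -ekj qbinom_even_sym.
have -> : (n - j = k)%N by lia.
by rewrite -ekj; case: k j {ekj} => [|k] [|j]; nia.
Qed.

Lemma zdvdp_sum_qbinom_odd (m n : nat) :
  zdvdp (qpoch (- 'X) 'X n)
    (\sum_(0 <= k < n.+1)
       (-1) ^+ k * 'X ^+ (k * (k + 2 * m - 1)) * qbinom (2 * n) (2 * k + 1)).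
Proof.
(* The top term vanishes because 2n+1 > 2n; what is left has the length of a T sum and reflects with
   n-1 in place of n. *)
rewrite big_nat_recr //= qbinom_small ?mulr0 ?addr0; last lia.
case: n => [|n]; first by rewrite big_nil; apply: zdvdp0.
apply: (@zdvdp_qpochN_cancel _ (n * (n - 1))).
rewrite (@sum_reflect n _ 0 _
  (fun k => k * (k - 1) + 2 * (m + n - 1) * (n.+1 - 1 - k))%N
  _ (fun k => qbinom (2 * n.+1) (2 * k + 1))).
  by rewrite mul1r; apply: zdvdp_mull; case: (zdvdp_qS_qT n.+1 (m + n - 1)).
move=> k j ekj; split; last by rewrite -ekj qbinom_odd_sym.
have -> : (n.+1 - 1 - j = k)%N by lia.
by rewrite -ekj; case: k j {ekj} => [|k] [|j]; nia.
Qed.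

Theorem theorem3p1 :
  (forall m n : nat,
      zdvdp (qpoch (- 'X) 'X n) (qS m n) /\ zdvdp (qpoch (- 'X) 'X n) (qT m n))
  /\ (forall m n d : nat, d = 0%N \/ d = 1%N ->
      zdvdp (qpoch (- 'X) 'X n)
        (\sum_(0 <= k < n.+1)
           (-1) ^+ k * 'X ^+ (k * (k + 2 * m - 1)) * qbinom (2 * n) (2 * k + d))).
Proof.
split=> [m n | m n _ [] ->]; first exact: zdvdp_qS_qT.
  under eq_bigr do rewrite addn0; exact: zdvdp_sum_qbinom_even.
exact: zdvdp_sum_qbinom_odd.
Qed.
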